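(* Let $k\geq 1$ be an integer. Let $G_k$ be the simple graph on $3k+3$ vertices whose vertex set is the disjoint union of $\{u\}$, $\{v\}$, a set $T$ with $|T|=k+1$, a set $L$ with $|L|=k$, and a set $R$ with $|R|=k$, and whose edges are exactly: the edge $uv$; all edges from $u$ to $T$ and all edges from $v$ to $T$; all edges from $u$ to $L$; all edges from $v$ to $R$; and all $k^2$ edges between $L$ and $R$. Let $G_k^-$ be the subgraph of $G_k$ on the same vertex set obtained by deleting the $k^2$ edges between $L$ and $R$ (a copy of $K_{k,k}$). Then $G_k$ and its subgraph $G_k^-$ are cospectral with respect to the normalized Laplacian, i.e. their normalized Laplacian matrices have the same eigenvalues counting multiplicity.
   Context: For a simple graph with no vertices of degree $0$, adjacency matrix $A$ and diagonal degree matrix $D$, the normalized Laplacian is $\mathcal{L}=D^{-1/2}(D-A)D^{-1/2}$. *)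

(* Defs.v *)
From HB Require Import structures.
From mathcomp Require Import all_boot all_order all_algebra.
From mathcomp Require Import complex.

Set Implicit Arguments.
Unset Strict Implicit.
Unset Printing Implicit Defensive.

Import Order.TTheory GRing.Theory Num.Theory.
Local Open Scope ring_scope.

Record simple_graph (V : finType) := SimpleGraph {
  adj :> rel V;
  adj_sym : symmetric adj;
  adj_irr : irreflexive adj
}.

Definition degree (V : finType) (G : simple_graph V) (x : V) : nat :=
  #|[set y | G x y]|.

Section Laplacian.
Variables (R : rcfType) (V : finType) (G : simple_graph V).

(* Matrices are indexed by the vertices through the enumeration of V. *)
Definition adjacency_mx : 'M[R]_#|V| :=
  \matrix_(i, j) (G (enum_val i) (enum_val j))%:R.

Definition degree_mx : 'M[R]_#|V| :=
  diag_mx (\row_i (degree G (enum_val i))%:R).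

Definition degree_invsqrt_mx : 'M[R]_#|V| :=
  diag_mx (\row_i (Num.sqrt (degree G (enum_val i))%:R)^-1).

(* Since 0^-1 = 0, this is meaningful only if no vertex has degree 0. *)
Definition normalized_laplacian : 'M[R]_#|V| :=
  degree_invsqrt_mx *m (degree_mx - adjacency_mx) *m degree_invsqrt_mx.

End Laplacian.

(* Algebraic multiplicity of a complex number z as an eigenvalue of a real
   matrix; it is 0 when z is not an eigenvalue. *)
Definition eigenvalue_mult (R : rcfType) (n : nat) (A : 'M[R]_n) (z : R[i]) :
  nat := mup z (char_poly (map_mx (real_complex R) A)).

Definition normalized_cospectral (R : rcfType) (V W : finType)
    (G : simple_graph V) (H : simple_graph W) : Prop :=
  forall z : R[i], eigenvalue_mult (normalized_laplacian R G) z =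
                   eigenvalue_mult (normalized_laplacian R H) z.

Inductive vertex (k : nat) : Type :=
  | Vu | Vv | VT of 'I_k.+1 | VL of 'I_k | VR of 'I_k.
Arguments Vu {k}.
Arguments Vv {k}.

Section Vertex.
Variable k : nat.

Definition vertex_code (x : vertex k) : bool + 'I_k.+1 + ('I_k + 'I_k) :=
  match x with
  | Vu => inl (inl true)
  | Vv => inl (inl false)
  | VT i => inl (inr i)
  | VL i => inr (inl i)
  | VR i => inr (inr i)
  end.

Definition vertex_decode (c : bool + 'I_k.+1 + ('I_k + 'I_k)) : vertex k :=
  match c with
  | inl (inl true) => Vu
  | inl (inl false) => Vv
  | inl (inr i) => VT i
  | inr (inl i) => VL i
  | inr (inr i) => VR i
  end.

Lemma vertex_codeK : cancel vertex_code vertex_decode.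
Proof. by case. Qed.

Lemma vertex_decodeK : cancel vertex_decode vertex_code.
Proof. by case=> [[[]|]|[]]. Qed.

End Vertex.

HB.instance Definition _ k := Finite.copy (vertex k) (can_type (@vertex_codeK k)).

Lemma card_vertex k : #|{: vertex k}| = (3 * k + 3)%N.
Proof.
rewrite (bij_eq_card (Bijective (@vertex_codeK k) (@vertex_decodeK k))).
rewrite !card_sum card_bool !card_ord mulSn mulSn mul1n.
by rewrite !addnS !addSn !addn0 add0n.
Qed.

(* Each edge of G_k, listed in one orientation only. *)
Definition Gk_arc k (x y : vertex k) : bool :=
  match x, y with
  | Vu, Vv | Vu, VT _ | Vv, VT _ | Vu, VL _ | Vv, VR _ | VL _, VR _ => true
  | _, _ => false
  end.

Definition Gk_adj k (x y : vertex k) : bool := Gk_arc x y || Gk_arc y x.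

Lemma Gk_adj_sym k : symmetric (@Gk_adj k).
Proof. by move=> x y; rewrite /Gk_adj orbC. Qed.

Lemma Gk_adj_irr k : irreflexive (@Gk_adj k).
Proof. by case. Qed.

Definition Gk k : simple_graph (vertex k) :=
  SimpleGraph (@Gk_adj_sym k) (@Gk_adj_irr k).

Definition between_LR k (x y : vertex k) : bool :=
  match x, y with
  | VL _, VR _ | VR _, VL _ => true
  | _, _ => false
  end.

Definition Gk_minus_adj k (x y : vertex k) : bool :=
  Gk k x y && ~~ between_LR x y.

Lemma Gk_minus_adj_sym k : symmetric (@Gk_minus_adj k).
Proof. by case=> [||?|?|?] [||?|?|?]. Qed.

Lemma Gk_minus_adj_irr k : irreflexive (@Gk_minus_adj k).
Proof. by case. Qed.

Definition Gk_minus k : simple_graph (vertex k) :=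
  SimpleGraph (@Gk_minus_adj_sym k) (@Gk_minus_adj_irr k).

Lemma Gk_minus_degree_gt0 k (x : vertex k) : (0 < degree (Gk_minus k) x)%N.
Proof.
apply/card_gt0P; case: x => [||i|i|i];
  by [exists Vu; rewrite inE | exists Vv; rewrite inE].
Qed.

Lemma Gk_degree_gt0 k (x : vertex k) : (0 < degree (Gk k) x)%N.
Proof.
apply: leq_trans (Gk_minus_degree_gt0 x) _.
by apply/subset_leq_card/subsetP => y; rewrite !inE => /andP[].
Qed.

(* Main.v *)
Require Import Defs.
From mathcomp Require Import all_boot all_order all_algebra.
From mathcomp Require Import complex ring lra.

Set Implicit Arguments.
Unset Strict Implicit.
Unset Printing Implicit Defensive.

Import Order.TTheory GRing.Theory Num.Theory.
Local Open Scope ring_scope.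

(** Write P for the random-walk matrix D^-1 A, so that the normalized Laplacian
    is similar to 1 - P. In both graphs the vertices of T are twins, and so are
    those of L and those of R: whether two vertices are adjacent depends only on
    their cells in the partition {u}, {v}, T, L, R. Hence P factors through the
    functions on the five cells, and the commutation of characteristic
    polynomials of A B and B A ([char_poly_twin_quotient]) reduces the spectrum
    of the Laplacian to that of the 5 x 5 quotient walk, every remaining
    eigenvalue being 1 with the same multiplicity in both graphs.

    The swap u <-> v, L <-> R splits each quotient walk into a symmetric part of
    dimension 3 and an antisymmetric part of dimension 2. With
    s = 1 / (2k + 2), let q be the polynomial X^2 + s X - k s. Then
    - for G_k, the symmetric part has characteristic polynomial (X - 1) q and
      the antisymmetric part X (X + (2k + 1) s);
    - for G_k^-, the symmetric part has X (X - 1) (X + (2k + 1) s) and the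
      antisymmetric part q.
    So deleting the edges between L and R moves the pair of roots of q from one
    part to the other and leaves the spectrum unchanged. The lemmas
    [Gk_basis_walk] and [Gk_minus_basis_walk] exhibit this by bringing both
    quotient walks to the same block diagonal matrix, whose last block is a
    companion matrix of q. *)

(** * Characteristic polynomials *)

(** Both sides are the determinant of the block matrix (a, -A; B, 1), multiplied
    on the right by a block matrix clearing its lower left or its upper right
    corner. *)
Lemma det_scalarD_mulmxC (R : comNzRingType) m n (a : R)
    (A : 'M[R]_(m, n)) (B : 'M[R]_(n, m)) :
  \det (a%:M + A *m B) * a ^+ n = a ^+ m * \det (a%:M + B *m A).
Proof.
pose M := block_mx a%:M (- A) B 1%:M.
have detM : \det M = \det (a%:M + A *m B).
  have: M *m block_mx 1%:M 0 (- B) 1%:M =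
        block_mx (a%:M + A *m B) (- A) 0 1%:M.
    rewrite mulmx_block !mulmx1 !mulmx0 !mul1mx !add0r.
    by rewrite mulNmx mulmxN opprK addrN.
  move/(congr1 determinant).
  by rewrite det_mulmx det_lblock det_ublock !det1 !mulr1.
have: M *m block_mx 1%:M A 0 a%:M = block_mx a%:M 0 B (a%:M + B *m A).
  rewrite mulmx_block !mulmx1 !mulmx0 !mul1mx !addr0 mulNmx.
  by rewrite -scalar_mxC addrN addrC.
move/(congr1 determinant).
by rewrite det_mulmx det_lblock det_ublock det1 mul1r !det_scalar detM.
Qed.

Lemma char_poly_mx1B (R : comNzRingType) n (A : 'M[R]_n) :
  char_poly_mx (1%:M - A) = ('X - 1)%:M + map_mx polyC A.
Proof.
rewrite /char_poly_mx map_mxB map_scalar_mx rmorph1 [('X - 1)%:M]raddfB /=.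
by rewrite opprB addrA addrAC.
Qed.

Lemma char_poly_1B_mulmxC (R : comNzRingType) m n
    (A : 'M[R]_(m, n)) (B : 'M[R]_(n, m)) :
  char_poly (1%:M - A *m B) * ('X - 1) ^+ n =
  ('X - 1) ^+ m * char_poly (1%:M - B *m A).
Proof. by rewrite /char_poly !char_poly_mx1B !map_mxM det_scalarD_mulmxC. Qed.

Lemma char_poly_intertwine (R : idomainType) n (A M F : 'M[R]_n) :
  \det F != 0 -> A *m F = F *m M -> char_poly A = char_poly M.
Proof.
move=> F_neq0 AF.
have FC_neq0 : \det (map_mx polyC F) != 0 by rewrite det_map_mx polyC_eq0.
apply: (mulIf FC_neq0); rewrite [RHS]mulrC -!det_mulmx.
by rewrite mulmxBl mulmxBr -!map_mxM AF scalar_mxC.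
Qed.

(** A left inverse up to a nonzero diagonal matrix certifies invertibility
    without expanding the determinant. *)
Lemma det_neq0_diag (R : idomainType) n (E F : 'M[R]_n) (d : 'rV[R]_n) :
  E *m F = diag_mx d -> (forall i, d 0 i != 0) -> \det F != 0.
Proof.
move=> /(congr1 determinant); rewrite det_mulmx det_diag => detEF d_neq0.
have : \det E * \det F != 0 by rewrite detEF; apply/prodf_neq0 => i _.
by rewrite mulf_eq0 negb_or => /andP[].
Qed.

(** * Graphs whose adjacency depends only on cells *)

Section TwinQuotient.
Variables (R : rcfType) (V : finType) (G : simple_graph V).
Variables (m : nat) (cell : V -> 'I_m) (B : rel 'I_m).
Hypothesis adjE : forall x y, G x y = B (cell x) (cell y).
Hypothesis degree_gt0 : forall x, (0 < degree G x)%N.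

Definition cell_size (b : 'I_m) : nat := #|[set x | cell x == b]|.

Definition cell_degree (a : 'I_m) : nat := \sum_b B a b * cell_size b.

(** The transition probabilities of the simple random walk between cells, that
    is, the action of D^-1 A on the functions constant on cells. *)
Definition quotient_walk : 'M[R]_m :=
  \matrix_(a, b) ((B a b)%:R * (cell_size b)%:R / (cell_degree a)%:R).

Lemma degree_cell x : degree G x = cell_degree (cell x).
Proof.
rewrite /degree /cell_degree -sum1dep_card (partition_big cell predT) //=.
apply: eq_bigr => b _; rewrite /cell_size -sum1dep_card big_distrr /=.
under eq_bigl do rewrite adjE.
rewrite big_mkcondl; apply: eq_bigr => y /eqP <-; rewrite muln1.
by case: (B _ _).
Qed.

Let root x : R := Num.sqrt (degree G x)%:R.

Let root_neq0 x : root x != 0.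
Proof. by rewrite sqrtr_eq0 -ltNge ltr0n. Qed.

Let root2 x : root x * root x = (degree G x)%:R.
Proof. by rewrite -expr2 sqr_sqrtr ?ler0n. Qed.

(* U extends a function on cells to the vertices, and W averages over the
   neighbours; the square roots are shared out so that U W is the symmetric
   matrix D^(-1/2) A D^(-1/2) while they cancel in W U. *)
Let U : 'M[R]_(#|V|, m) :=
  \matrix_(i, a) ((cell (enum_val i) == a)%:R * root (enum_val i)).

Let W : 'M[R]_(m, #|V|) :=
  \matrix_(a, j) ((B a (cell (enum_val j)))%:R / (cell_degree a)%:R /
                  root (enum_val j)).

Let laplacianE : normalized_laplacian R G = 1%:M - U *m W.
Proof.
apply/matrixP=> i j.
rewrite /normalized_laplacian mul_diag_mx mul_mx_diag !mxE.
set x := enum_val i; set y := enum_val j.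
rewrite (bigD1 (cell x)) //= big1 ?addr0; last first.
  by move=> a xa; rewrite !mxE eq_sym (negbTE xa) !mul0r.
rewrite !mxE eqxx mul1r -adjE -degree_cell.
rewrite -/x -/y -/(root x) -/(root y) -root2.
case: (eqVneq i j) => [eq_ij|_].
  have -> : y = x by rewrite /y -eq_ij.
  by rewrite /= mulr1n; field; apply: root_neq0.
rewrite /= mulr0n; field.
by rewrite !root_neq0.
Qed.

Let quotient_walkE : W *m U = quotient_walk.
Proof.
apply/matrixP=> a b; rewrite !mxE.
under eq_bigr do rewrite !mxE.
pose f x : R := (B a (cell x))%:R / (cell_degree a)%:R / root x *
  ((cell x == b)%:R * root x).
transitivity (\sum_x f x).
  rewrite (reindex (@enum_val V V)); last exact/onW_bij/enum_val_bij.
  by [].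
rewrite (bigID (fun x => cell x == b)) /= [X in _ + X]big1 ?addr0; last first.
  by move=> x /negbTE xb; rewrite /f xb mul0r mulr0.
rewrite (eq_bigr (fun=> (B a b)%:R / (cell_degree a)%:R)); last first.
  by move=> x xb; rewrite /f xb mul1r mulfVK ?(eqP xb).
by rewrite sumr_const -[LHS]mulr_natr mulrAC /cell_size cardsE.
Qed.

(** The Laplacian is 1 - U W, the quotient walk is W U, and the products U W and
    W U have the same nonzero eigenvalues. Powers of X - 1 stand on both sides
    because some cells may be empty and m may exceed the number of vertices. *)
Lemma char_poly_twin_quotient :
  char_poly (normalized_laplacian R G) * ('X - 1) ^+ m =
  ('X - 1) ^+ #|V| * char_poly (1%:M - quotient_walk).
Proof. by rewrite laplacianE char_poly_1B_mulmxC quotient_walkE. Qed.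

End TwinQuotient.

(** * The quotient walks of the two graphs *)

Section Cells.
Variable k : nat.

(** The cells {u}, {v}, T, L, R are numbered from 0 to 4 in this order. *)
Definition vertex_cell (x : vertex k) : 'I_5 :=
  match x with
  | Vu => @Ordinal 5 0 isT
  | Vv => @Ordinal 5 1 isT
  | VT _ => @Ordinal 5 2 isT
  | VL _ => @Ordinal 5 3 isT
  | VR _ => @Ordinal 5 4 isT
  end.

Definition table (T : Type) (x0 : T) (rows : seq (seq T)) (a b : 'I_5) : T :=
  nth x0 (nth [::] rows a) b.

Definition Gk_pattern : rel 'I_5 := table false
  [:: [:: false; true;  true;  true;  false];
      [:: true;  false; true;  false; true];
      [:: true;  true;  false; false; false];
      [:: true;  false; false; false; true];
      [:: false; true;  false; true;  false]].

Definition Gk_minus_pattern : rel 'I_5 := table false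
  [:: [:: false; true;  true;  true;  false];
      [:: true;  false; true;  false; true];
      [:: true;  true;  false; false; false];
      [:: true;  false; false; false; false];
      [:: false; true;  false; false; false]].

Lemma Gk_patternE x y :
  Gk k x y = Gk_pattern (vertex_cell x) (vertex_cell y).
Proof. by case: x y => [||?|?|?] [||?|?|?]. Qed.

Lemma Gk_minus_patternE x y :
  Gk_minus k x y = Gk_minus_pattern (vertex_cell x) (vertex_cell y).
Proof. by case: x y => [||?|?|?] [||?|?|?]. Qed.

Lemma vertex_cell_size b :
  cell_size vertex_cell b = nth 0%N [:: 1; 1; k.+1; k; k]%N b.
Proof.
have sizeI (T : finType) (f : T -> vertex k) : injective f ->
    (forall x, (vertex_cell x == b) = (x \in codom f)) ->
    cell_size vertex_cell b = #|T|.
  move=> f_inj fP; rewrite /cell_size -(card_codom f_inj).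
  by apply: eq_card => x; rewrite inE fP.
case: b sizeI => [] [|[|[|[|[|//]]]]] ltb sizeI /=.
- rewrite (sizeI unit (fun=> Vu)) ?card_unit //; first by case=> [] [].
  move=> x; apply/idP/codomP => [|[i ->] //].
  by case: x => // _; exists tt.
- rewrite (sizeI unit (fun=> Vv)) ?card_unit //; first by case=> [] [].
  move=> x; apply/idP/codomP => [|[i ->] //].
  by case: x => // _; exists tt.
- rewrite (sizeI _ (@VT k)) ?card_ord //; first by move=> i j [].
  move=> x; apply/idP/codomP => [|[i ->] //].
  by case: x => // i _; exists i.
- rewrite (sizeI _ (@VL k)) ?card_ord //; first by move=> i j [].
  move=> x; apply/idP/codomP => [|[i ->] //].
  by case: x => // i _; exists i.
- rewrite (sizeI _ (@VR k)) ?card_ord //; first by move=> i j [].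
  move=> x; apply/idP/codomP => [|[i ->] //].
  by case: x => // i _; exists i.
Qed.

Variable R : rcfType.
Let K : R := k%:R.

Let K_ge0 : 0 <= K. Proof. exact: ler0n. Qed.

Definition mx5 (rows : seq (seq R)) : 'M[R]_5 :=
  \matrix_(a, b) table 0 rows a b.

Let s : R := (2 * (K + 1))^-1.

Lemma Gk_quotient_walk :
  quotient_walk R vertex_cell Gk_pattern = mx5
    [:: [:: 0;           s;           1 / 2; K * s;       0];
        [:: s;           0;           1 / 2; 0;           K * s];
        [:: 1 / 2;       1 / 2;       0;     0;           0];
        [:: (K + 1)^-1;  0;           0;     0;           K / (K + 1)];
        [:: 0;           (K + 1)^-1;  0;     K / (K + 1); 0]].
Proof.
apply/matrixP=> a b; rewrite !mxE /cell_degree.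
rewrite !big_ord_recl big_ord0 !vertex_cell_size.
have ? := K_ge0.
case: a => [] [|[|[|[|[|//]]]]] lta; case: b => [] [|[|[|[|[|//]]]]] ltb;
  rewrite /Gk_pattern /table /= ?(natrD, natrM, mulr0n, mulr1n);
  rewrite ?mulrSr ?mulr0n -/K /s; field; lra.
Qed.

Lemma Gk_minus_quotient_walk :
  quotient_walk R vertex_cell Gk_minus_pattern = mx5
    [:: [:: 0;     s;     1 / 2; K * s; 0];
        [:: s;     0;     1 / 2; 0;     K * s];
        [:: 1 / 2; 1 / 2; 0;     0;     0];
        [:: 1;     0;     0;     0;     0];
        [:: 0;     1;     0;     0;     0]].
Proof.
apply/matrixP=> a b; rewrite !mxE /cell_degree.
rewrite !big_ord_recl big_ord0 !vertex_cell_size.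
have ? := K_ge0.
case: a => [] [|[|[|[|[|//]]]]] lta; case: b => [] [|[|[|[|[|//]]]]] ltb;
  rewrite /Gk_minus_pattern /table /= ?(natrD, natrM, mulr0n, mulr1n);
  rewrite ?mulrSr ?mulr0n -/K /s; field; lra.
Qed.

(** The common block form of the two quotient walks; the last block has
    characteristic polynomial X^2 + s X - K s, whose roots are in general
    irrational, and is left undiagonalized. *)
Definition walk_model : 'M[R]_5 := mx5
  [:: [:: 1; 0; 0;                    0;   0];
      [:: 0; 0; 0;                    0;   0];
      [:: 0; 0; - ((2 * K + 1) * s);  0;   0];
      [:: 0; 0; 0;                    - s; K * s];
      [:: 0; 0; 0;                    1;   0]].

(** Columns: the constants; antisymmetric eigenvectors for 0 and for
    - (2k + 1) s; then two symmetric vectors spanning the complement of the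
    constants that is orthogonal to them for the stationary measure. The fourth
    is chosen to vanish on L and R, and the last is its image under P + s, as
    the shape of the companion block requires. *)
Definition Gk_basis : 'M[R]_5 := mx5
  [:: [:: 1; K;   - 1; K + 1;         - K];
      [:: 1; - K; 1;   K + 1;         - K];
      [:: 1; 0;   0;   - 2 * (K + 1); K];
      [:: 1; 1;   2;   0;             1];
      [:: 1; - 1; - 2; 0;             1]].

(** Columns: the constants; symmetric eigenvectors for 0 and for
    - (2k + 1) s; then the antisymmetric indicators of u, v and of L, R. *)
Definition Gk_minus_basis : 'M[R]_5 := mx5
  [:: [:: 1; 0;         - (2 * K + 1); 1;   0];
      [:: 1; 0;         - (2 * K + 1); - 1; 0];
      [:: 1; K;         2 * (K + 1);   0;   0];
      [:: 1; - (K + 1); 2 * (K + 1);   0;   1];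
      [:: 1; - (K + 1); 2 * (K + 1);   0;   - 1]].

Lemma Gk_basis_walk :
  quotient_walk R vertex_cell Gk_pattern *m Gk_basis = Gk_basis *m walk_model.
Proof.
have ? := K_ge0; rewrite Gk_quotient_walk.
apply/matrixP=> a b; rewrite !mxE !big_ord_recl !big_ord0 !mxE.
case: a => [] [|[|[|[|[|//]]]]] lta; case: b => [] [|[|[|[|[|//]]]]] ltb;
  rewrite /table /= /s; field; lra.
Qed.

Lemma Gk_minus_basis_walk :
  quotient_walk R vertex_cell Gk_minus_pattern *m Gk_minus_basis =
  Gk_minus_basis *m walk_model.
Proof.
have ? := K_ge0; rewrite Gk_minus_quotient_walk.
apply/matrixP=> a b; rewrite !mxE !big_ord_recl !big_ord0 !mxE.
case: a => [] [|[|[|[|[|//]]]]] lta; case: b => [] [|[|[|[|[|//]]]]] ltb;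
  rewrite /table /= /s; field; lra.
Qed.

Lemma Gk_basis_det_neq0 : \det Gk_basis != 0.
Proof.
(* The walk is reversible, so eigenvectors for distinct eigenvalues are
   orthogonal for the stationary measure, here proportional to (2, 2, 2, K, K).
   The first three rows of F' are eigenvectors weighted by it; the last two are
   the symmetric rows dual to the last two columns. *)
pose F' := mx5
  [:: [:: 2;     2;     2;           K;       K];
      [:: 2;     - 2;   0;           1;       - 1];
      [:: - 1;   1;     0;           K;       - K];
      [:: K - 1; K - 1; 2 * (K + 1); - 2 * K; - 2 * K];
      [:: 2;     2;     2;           - 3;     - 3]].
pose d : 'rV[R]_5 := \row_i nth 0 [:: 2 * K + 6; 4 * K + 2; 4 * K + 2;
  - (2 * K + 6) * (K + 1); - (2 * K + 6)] i.
apply: (@det_neq0_diag _ _ F' _ d).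
  apply/matrixP=> a b; rewrite !mxE !big_ord_recl !big_ord0 !mxE.
  case: a => [] [|[|[|[|[|//]]]]] lta; case: b => [] [|[|[|[|[|//]]]]] ltb;
    rewrite /table /= ?mulr0n ?mulr1n; ring.
have ? := K_ge0.
by case=> [] [|[|[|[|[|//]]]]] lti; rewrite mxE /= ?oppr_eq0 ?mulf_neq0 //; lra.
Qed.

Lemma Gk_minus_basis_det_neq0 : \det Gk_minus_basis != 0.
Proof.
(* As above, with stationary measure proportional to
   (2 (K + 1), 2 (K + 1), 2 (K + 1), K, K); the columns are now pairwise
   orthogonal, so each row of F' is a weighted column up to a scalar. *)
pose F' := mx5
  [:: [:: 2 * (K + 1);   2 * (K + 1);   2 * (K + 1); K;   K];
      [:: 0;             0;             2;           - 1; - 1];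
      [:: - (2 * K + 1); - (2 * K + 1); 2 * (K + 1); K;   K];
      [:: 1;             - 1;           0;           0;   0];
      [:: 0;             0;             0;           1;   - 1]].
pose d : 'rV[R]_5 := \row_i nth 0 [:: 8 * K + 6; 4 * K + 2;
  2 * (2 * K + 1) * (4 * K + 3); 2; 2] i.
apply: (@det_neq0_diag _ _ F' _ d).
  apply/matrixP=> a b; rewrite !mxE !big_ord_recl !big_ord0 !mxE.
  case: a => [] [|[|[|[|[|//]]]]] lta; case: b => [] [|[|[|[|[|//]]]]] ltb;
    rewrite /table /= ?mulr0n ?mulr1n; ring.
have ? := K_ge0.
by case=> [] [|[|[|[|[|//]]]]] lti; rewrite mxE /= ?mulf_neq0 //; lra.
Qed.

End Cells.

(** * Cospectrality *)

Lemma char_poly_Gk (R : rcfType) (k : nat) :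
  char_poly (normalized_laplacian R (Gk k)) =
  char_poly (normalized_laplacian R (Gk_minus k)).
Proof.
have X1_neq0 : ('X - 1) ^+ 5 != 0 :> {poly R}.
  by rewrite expf_neq0 // -polyC1 polyXsubC_eq0.
apply: (mulIf X1_neq0).
rewrite (char_poly_twin_quotient R (@Gk_patternE k) (@Gk_degree_gt0 k)).
rewrite (char_poly_twin_quotient R (@Gk_minus_patternE k)
           (@Gk_minus_degree_gt0 k)).
congr (_ * _).
transitivity (char_poly (1%:M - walk_model k R)).
  apply: (char_poly_intertwine (Gk_basis_det_neq0 k R)).
  by rewrite mulmxBl mulmxBr mul1mx mulmx1 Gk_basis_walk.
apply/esym/(char_poly_intertwine (Gk_minus_basis_det_neq0 k R)).
by rewrite mulmxBl mulmxBr mul1mx mulmx1 Gk_minus_basis_walk.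
Qed.

Theorem mainTheorem4 (R : rcfType) (k : nat) (hk : (1 <= k)%N) :
  normalized_cospectral R (Gk k) (Gk_minus k).
Proof.
by move=> z; rewrite /eigenvalue_mult -!map_char_poly char_poly_Gk.
Qed.
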